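(* Let $G$ be a nontrivial finite abelian $p$-group. Then $\kappa(\mathcal{G}(G))=\delta(\mathcal{G}(G))$ if and only if $\sigma(G)=1$ or $\tau(G)=2$.
   Context: A $p$-group is a finite group whose order is a power of the prime $p$. A finite abelian group $G$ is isomorphic to a unique direct product of cyclic groups of prime power order; $\sigma(G)$ is the number of cyclic factors and $\tau(G)$ the order of the smallest cyclic factor. The power graph $\mathcal{G}(G)$ has vertex set $G$, distinct $u,v$ adjacent iff one is a positive integer power of the other. $\delta$ is minimum degree and $\kappa$ vertex connectivity (minimum number of vertices whose removal yields a disconnected or trivial graph). *)

(* Defs.v *)
From HB Require Import structures.
From mathcomp Require Import all_boot all_fingroup all_solvable.

Set Implicit Arguments.
Unset Strict Implicit.
Unset Printing Implicit Defensive.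

(** ** Finite simple graphs: vertex set [V : {set T}], adjacency [e : rel T] *)

Definition degree (T : finType) (V : {set T}) (e : rel T) (x : T) : nat :=
  #|[set y in V | e x y]|.

(* Degrees are at most [#|V|], so the default value of the big operator is
   irrelevant as soon as [V] is nonempty. *)
Definition min_degree (T : finType) (V : {set T}) (e : rel T) : nat :=
  \big[minn/#|V|]_(x in V) degree V e x.

Definition connected_graph (T : finType) (V : {set T}) (e : rel T) : bool :=
  [forall x in V, forall y in V,
     connect [rel u v | [&& u \in V, v \in V & e u v]] x y].

Definition trivial_graph (T : finType) (V : {set T}) : bool := #|V| == 1.

(* [X] ranges over the sets of vertices whose removal leaves a disconnected or a
   one-vertex graph; if [V] is nonempty there is such an [X], and the default
   value [#|V|] is then irrelevant. *)
Definition vertex_connectivity (T : finType) (V : {set T}) (e : rel T) : nat :=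
  \big[minn/#|V|]_(X : {set T} |
       (X \subset V) &&
       (~~ connected_graph (V :\: X) e || trivial_graph (V :\: X))) #|X|.

Local Open Scope group_scope.

(** ** The power graph: vertex set [G], adjacency [power_adj] *)

(* The positive powers of [x] are [x ^+ 1, ..., x ^+ #[x]]; see [pos_powerP]. *)
Definition pos_power (gT : finGroupType) (x y : gT) : bool :=
  [exists n : 'I_#[x], y == x ^+ n.+1].

Lemma pos_powerP (gT : finGroupType) (x y : gT) :
  reflect (exists n, (0 < n)%N /\ y = x ^+ n) (pos_power x y).
Proof.
apply: (iffP existsP) => [[n /eqP->]|[n [n_gt0 ->]]]; first by exists n.+1.
have lt_n : (n.-1 %% #[x] < #[x])%N by rewrite ltn_mod order_gt0.
exists (Ordinal lt_n) => /=.
by rewrite expgS expg_mod_order -expgS prednK.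
Qed.

Definition power_adj (gT : finGroupType) : rel gT :=
  [rel x y | (x != y) && (pos_power x y || pos_power y x)].

(** ** Decomposition of an abelian group into cyclic groups of prime power order *)

Definition prime_power (n : nat) : bool :=
  has (fun q => n == q ^ logn q n)%N (primes n).

Lemma prime_powerP (n : nat) :
  reflect (exists q k, [/\ prime q, (0 < k)%N & n = q ^ k]%N) (prime_power n).
Proof.
apply: (iffP hasP) => [[q q_n /eqP n_q]|[q [k [q_pr k_gt0 ->]]]].
  exists q, (logn q n); split=> //; last by rewrite logn_gt0.
  by move: q_n; rewrite mem_primes => /and3P[].
by exists q; rewrite ?pfactorK // primesX // primes_prime // mem_seq1.
Qed.

(* A set of factors suffices: the factors are nontrivial, so none can be repeated
   in an internal direct product. *)
Definition cyclic_decomposition (gT : finGroupType)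
    (S : {set {group gT}}) (G : {set gT}) : bool :=
  [forall H in S, cyclic (gval H) && prime_power #|gval H|]
  && (\big[dprod/1]_(H in S) gval H == G).

Lemma cyclic_decomposition_prod (gT : finGroupType)
    (S R : {set {group gT}}) (A B G : {group gT}) :
  A \x B = G -> cyclic_decomposition S A -> cyclic_decomposition R B ->
  cyclic_decomposition (S :|: R) G.
Proof.
move=> defG /andP[/forall_inP cS /eqP defA] /andP[/forall_inP cR /eqP defB].
apply/andP; split.
  by apply/forall_inP => H; rewrite inE => /orP[/cS|/cR].
have [_ _ _ tiAB] := dprodP defG.
have dSR : [disjoint S & R].
  apply/pred0P => H /=; apply/negP => /andP[HS HR].
  have /andP[_ /prime_powerP[q [k [q_pr k_gt0 oH]]]] := cS _ HS.
  have sHA : H \subset A by rewrite -(bigdprodWY defA) sub_gen // (bigcup_max H).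
  have sHB : H \subset B by rewrite -(bigdprodWY defB) sub_gen // (bigcup_max H).
  have H1 : H :=: 1 by apply/trivgP; rewrite -tiAB subsetI sHA.
  have := ltn_expl k (prime_gt1 q_pr).
  by rewrite -oH H1 cards1 ltnS leqNgt k_gt0.
rewrite -defG -defA -defB -bigU //=; apply/eqP/eq_bigl => H.
by rewrite !inE.
Qed.

Lemma cyclic_decomposition_exists (gT : finGroupType) (G : {group gT}) :
  abelian G -> exists S, cyclic_decomposition S G.
Proof.
have [n] := ubnP #|G|; elim: n G => // n IHn G leGn abG.
have split_case (A B : {group gT}) : A \x B = G -> A :!=: 1 -> B :!=: 1 ->
    exists S, cyclic_decomposition S G.
  move=> defG ntA ntB; have [_ defG' _ _] := dprodP defG.
  have sAG : A \subset G by rewrite -defG' mulG_subl.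
  have sBG : B \subset G by rewrite -defG' mulG_subr.
  have oG := dprod_card defG.
  have [|S dS] := IHn A _ (abelianS sAG abG).
    rewrite -ltnS (leq_trans _ leGn) // ltnS -oG ltn_Pmulr ?cardG_gt0 //.
    by rewrite cardG_gt1.
  have [|R dR] := IHn B _ (abelianS sBG abG).
    rewrite -ltnS (leq_trans _ leGn) // ltnS -oG ltn_Pmull ?cardG_gt0 //.
    by rewrite cardG_gt1.
  by exists (S :|: R); apply: cyclic_decomposition_prod defG dS dR.
have [G1 | ntG] := eqVneq (G : {set gT}) 1.
  exists set0; rewrite /cyclic_decomposition big_set0 G1 eqxx andbT.
  by apply/forall_inP => H; rewrite inE.
have [q q_pr q_G] : {q | prime q & q %| #|G|} by apply: pdivP; rewrite cardG_gt1.
have defO := nilpotent_pcoreC q (abelian_nil abG).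
have ntO : 'O_q(G) != 1.
  apply/eqP => O1; move: defO; rewrite O1 dprod1g => GO.
  have := pcore_pgroup q^' G; rewrite GO => /pgroupP/(_ q q_pr q_G).
  by rewrite !inE eqxx.
have [O'1 | ntO'] := eqVneq 'O_q^'(G) 1; last exact: split_case defO ntO ntO'.
have qG : q.-group G by rewrite -defO O'1 dprodg1 pcore_pgroup.
have [x Gx ox] := exponent_witness (abelian_nil abG).
have /splitsP[H /complP[tixH defG]] := abelian_splits Gx (esym ox) abG.
have dpG : <[x]> \x H = G.
  rewrite dprodE // (sub_abelian_cent2 abG) ?cycle_subG //.
  by rewrite -defG mulG_subr.
have [H1 | ntH] := eqVneq (H : {set gT}) 1.
  have defGx : G :=: <[x]> by rewrite -defG H1 mulg1.
  exists [set G]; rewrite /cyclic_decomposition big_set1 eqxx andbT.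
  apply/forall_inP => K; rewrite inE => /eqP->.
  rewrite {1}defGx cycle_cyclic /=.
  have [k oG] := p_natP qG; apply/prime_powerP; exists q, k; split=> //.
  by case: k oG => // oG; rewrite -cardG_gt1 oG in ntG.
apply: split_case dpG _ ntH.
by rewrite cycle_eq1 -order_eq1 -ox -dvdn1 -trivg_exponent.
Qed.

(* The factors of some decomposition.  It exists when [G] is abelian
   ([cyclic_factorsP]); the orders of the factors do not depend on the choice, see
   [cyclic_factors_abelian_type] for the case of p-groups. *)
Definition cyclic_factors (gT : finGroupType) (G : {set gT}) :
    {set {group gT}} :=
  odflt set0 [pick S : {set {group gT}} | cyclic_decomposition S G].

Lemma cyclic_factorsP (gT : finGroupType) (G : {group gT}) :
  abelian G -> cyclic_decomposition (cyclic_factors G) G.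
Proof.
move=> /cyclic_decomposition_exists[S dS].
by rewrite /cyclic_factors; case: pickP => [//|/(_ S)]; rewrite dS.
Qed.

Lemma cyclic_factors_abelian_type (gT : finGroupType) (p : nat)
    (G : {group gT}) (S : {set {group gT}}) :
  p.-group G -> cyclic_decomposition S G ->
  perm_eq [seq #|gval H| | H <- enum S] (abelian_type G).
Proof.
move=> pG /andP[/forall_inP cS /eqP defG].
pose g (H : {group gT}) : gT := odflt 1 [pick x | gval H == <[x]>].
have gP H : H \in S -> gval H = <[g H]>.
  move=> /cS/andP[/cyclicP[x Hx] _]; rewrite /g.
  by case: pickP => [y /eqP //|/(_ x)]; rewrite Hx eqxx.
have defG' : \big[dprod/1]_(x <- [seq g H | H <- enum S]) <[x]> = G.
  rewrite big_map big_enum -defG /=; apply: eq_bigr => H HS.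
  by rewrite -gP.
have nt1 : 1 \notin [seq g H | H <- enum S].
  apply/negP => /mapP[H]; rewrite mem_enum => HS g1.
  have /andP[_ /prime_powerP[q [k [q_pr k_gt0 oH]]]] := cS _ HS.
  have := ltn_expl k (prime_gt1 q_pr).
  by rewrite -oH gP // -g1 cycle1 cards1 ltnS leqNgt k_gt0.
rewrite perm_sym; apply: perm_trans (abelian_type_pgroup pG defG' nt1) _.
rewrite -map_comp; have -> // : [seq (order \o g) H | H <- enum S] =
  [seq #|gval H| | H <- enum S].
by apply/eq_in_map => H; rewrite mem_enum => HS; rewrite /= orderE -gP.
Qed.

Definition sigma (gT : finGroupType) (G : {set gT}) : nat :=
  #|cyclic_factors G|.

(* A factor has order at most [#|G|], so the default value of the big operator
   is irrelevant when [G] is a nontrivial abelian group. *)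
Definition tau (gT : finGroupType) (G : {set gT}) : nat :=
  \big[minn/#|G|]_(H in cyclic_factors G) #|gval H|.

(* Main.v *)
Require Import Defs.
From mathcomp Require Import all_boot all_fingroup all_solvable.

(** If [G] is cyclic, its power graph is complete, so both invariants equal
    [#|G| - 1]. Otherwise the identity is a cut vertex: adjacent nonidentity
    elements have the same subgroup of order [p] below them, and [G] has at least
    two such subgroups; hence the vertex connectivity is [1]. The minimum degree
    is then [1] iff some nonidentity element has the identity as its only
    neighbour, that is, iff some involution of [G] is not a square. An involution
    generating a direct factor is not a square, while if every cyclic factor has
    order other than [2], then every involution is a square, factor by factor. *)

(** * Minima as big operators *)

Section BigMinn.

Variables (I : finType) (d : nat) (P : pred I) (F : I -> nat).

Lemma bigminn_le i : P i -> \big[minn/d]_(j | P j) F j <= F i.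
Proof.
move=> Pi; rewrite unlock; have := mem_index_enum i.
elim: (index_enum I) => //= j s IHs; rewrite inE => /predU1P[<- | /IHs le_s].
  by rewrite Pi geq_minl.
by case: ifP => // _; rewrite (leq_trans (geq_minr _ _)).
Qed.

Lemma leq_bigminn m :
  m <= d -> (forall i, P i -> m <= F i) -> m <= \big[minn/d]_(i | P i) F i.
Proof.
by move=> le_md le_mF; elim/big_ind: _ => // a b; rewrite leq_min => -> ->.
Qed.

(** The default [d] can itself be the minimum; each use has to exclude that alternative by a
    cardinality argument. *)
Lemma bigminn_attained :
  \big[minn/d]_(i | P i) F i = d \/
  exists2 i, P i & \big[minn/d]_(j | P j) F j = F i.
Proof.
elim/big_ind: _ => [|a b Ha Hb|i Pi]; first by left.
  by rewrite /minn; case: ifP.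
by right; exists i.
Qed.

End BigMinn.

(** * Complete graphs *)

Section CompleteGraph.

Variables (T : finType) (V : {set T}) (e : rel T).
Hypothesis V_nonempty : V != set0.
Hypothesis e_irr : irreflexive e.
Hypothesis e_complete : {in V &, forall x y, x != y -> e x y}.

Lemma degree_complete x : x \in V -> degree V e x = #|V|.-1.
Proof.
move=> Vx; rewrite /degree (cardsD1 x V) Vx; apply: eq_card => y.
rewrite !inE; have [-> | ne_yx] := eqVneq y x; first by rewrite e_irr andbF.
by case Vy: (y \in V) => //=; rewrite e_complete // eq_sym.
Qed.

Lemma min_degree_complete : min_degree V e = #|V|.-1.
Proof.
have [x Vx] := set0Pn _ V_nonempty; apply/eqP; rewrite eqn_leq.
rewrite -{1}(degree_complete x Vx) (bigminn_le _ _ _ (degree V e)) //=.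
by apply: leq_bigminn => [|y Vy]; rewrite ?leq_pred // degree_complete.
Qed.

(** What remains after a removal is again complete, hence connected, so only removals leaving a
    single vertex count. *)
Lemma vertex_connectivity_complete : vertex_connectivity V e = #|V|.-1.
Proof.
have [x Vx] := set0Pn _ V_nonempty; apply/eqP; rewrite eqn_leq.
apply/andP; split; last first.
  apply: leq_bigminn => [|X /andP[sXV /orP[/negP[] | /eqP oVX]]].
  - exact: leq_pred.
  - apply/forall_inP=> y Wy; apply/forall_inP=> z Wz.
    have [-> | ne_yz] := eqVneq y z; first exact: connect0.
    apply: connect1; rewrite /= Wy Wz e_complete //.
      by case/setDP: Wy.
    by case/setDP: Wz.
  - by move: (cardsID X V); rewrite oVX (setIidPr sXV) addn1 => <-.
(* The bound is attained by removing every vertex except [x]. *)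
have -> : #|V|.-1 = #|V :\ x| by rewrite (cardsD1 x V) Vx.
apply: (bigminn_le _ _ _ (fun X : {set T} => #|X|)).
rewrite subsetDl /=; apply/orP; right.
rewrite /trivial_graph setDDr setDv set0U (setIidPr _) ?sub1set //.
by rewrite cards1.
Qed.

End CompleteGraph.

Local Open Scope group_scope.

(** * Power graphs of abelian [p]-groups *)

Section PowerGraph.

Variable gT : finGroupType.
Implicit Types (p : nat) (x y : gT) (G : {group gT}).

Lemma pos_powerE x y : pos_power x y = (y \in <[x]>).
Proof.
apply/pos_powerP/cycleP=> [[n [_ ->]] | [i ->]]; first by exists n.
(* Adding the order makes the exponent positive without changing the power. *)
exists (i + #[x])%N; rewrite addn_gt0 order_gt0 orbT.
by rewrite expgD expg_order mulg1.
Qed.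

Lemma power_adjE x y :
  power_adj x y = (x != y) && ((y \in <[x]>) || (x \in <[y]>)).
Proof. by rewrite /power_adj /= !pos_powerE. Qed.

Lemma power_adj1 x : power_adj x 1 = (x != 1).
Proof. by rewrite power_adjE group1 /= andbT. Qed.

Lemma power_adj_sym x y : power_adj x y = power_adj y x.
Proof. by rewrite !power_adjE eq_sym orbC. Qed.

(** Orders of elements are powers of [p], so one divides the other, and in a cyclic group
    divisibility of orders gives inclusion of subgroups. *)
Lemma power_adj_cyclic p G :
  p.-group G -> cyclic G -> {in G &, forall x y, x != y -> power_adj x y}.
Proof.
move=> pG cG x y Gx Gy ne_xy; rewrite power_adjE ne_xy /=.
have cyc_dvd u v : u \in G -> v \in G -> #[u] %| #[v] -> u \in <[v]>.
  by move=> Gu Gv; rewrite -cycle_subG -(cardSg_cyclic cG) ?cycle_subG.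
have [m om] := p_natP (mem_p_elt pG Gx); have [n on] := p_natP (mem_p_elt pG Gy).
by case/orP: (leq_total m n) => /(dvdn_exp2l p); rewrite -om -on => /cyc_dvd->;
  rewrite ?orbT.
Qed.

(** For [x] nontrivial, ['Ohm_1(<[x]>)] is the unique subgroup of order [p] of [<[x]>], so nested
    cycles share it. It is thus constant on components once the identity is removed. *)
Lemma Ohm1_cycle_adj p G x y : prime p -> p.-group G ->
  x \in G^# -> y \in G^# -> power_adj x y ->
  'Ohm_1(<[x]>) = 'Ohm_1(<[y]>).
Proof.
move=> p_pr pG.
have sub_eq u v : u \in G^# -> v \in G^# -> v \in <[u]> ->
    'Ohm_1(<[v]>) = 'Ohm_1(<[u]>).
  have oO w : w \in G^# -> #|'Ohm_1(<[w]>)| = p.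
    rewrite !inE => /andP[nt_w Gw].
    by rewrite (Ohm1_cyclic_pgroup_prime (cycle_cyclic w) (mem_p_elt pG Gw))
      ?cycle_eq1.
  move=> Gu Gv uv; apply/eqP; rewrite eqEcard OhmS ?cycle_subG //=.
  by rewrite !oO.
move=> Gx Gy; rewrite power_adjE => /andP[_ /orP[xy | yx]]; last exact: sub_eq.
by apply/esym/sub_eq.
Qed.

(** Otherwise ['Ohm_1(<[x]>)] would contain every element of order [p], so ['Ohm_1(G)] would have
    order [p] and [G] would have rank one. *)
Lemma exists_Ohm1_cycle_neq p G : prime p -> p.-group G -> abelian G ->
  ~~ cyclic G ->
  exists x y, [/\ x \in G^#, y \in G^# & 'Ohm_1(<[x]>) != 'Ohm_1(<[y]>)].
Proof.
move=> p_pr pG abG ncG.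
have ntG : G :!=: 1 by apply: contraNneq ncG => ->; apply: cyclic1.
have [x Gx nt_x] := trivgPn _ ntG.
have G'x : x \in G^# by rewrite !inE nt_x.
have [/exists_inP[y Gy ne_y] | /exists_inPn eqO] :=
  boolP [exists y in G^#, 'Ohm_1(<[x]>) != 'Ohm_1(<[y]>)].
  by exists x, y.
case/negP: ncG; rewrite abelian_rank1_cyclic // (rank_pgroup pG).
rewrite p_rank_abelian //.
have oO : #|'Ohm_1(<[x]>)| = p.
  by rewrite (Ohm1_cyclic_pgroup_prime (cycle_cyclic x) (mem_p_elt pG Gx))
    ?cycle_eq1.
apply: (@leq_trans (logn p #|'Ohm_1(<[x]>)|)); last by rewrite oO logn_prime ?eqxx.
apply: dvdn_leq_log; first exact: cardG_gt0.
apply: cardSg => /=.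
rewrite (OhmE 1 pG) gen_subG; apply/subsetP=> y; rewrite !inE expn1 /=.
case/andP=> Gy /eqP yp1; have [-> // | nt_y] := eqVneq y 1.
have /eqP-> : 'Ohm_1(<[x]>) == 'Ohm_1(<[y]>).
  by rewrite -[_ == _]negbK eqO // !inE nt_y.
rewrite (OhmE 1 (mem_p_elt pG Gy)) mem_gen //.
by rewrite !inE cycle_id expn1 yp1 eqxx.
Qed.

Lemma vertex_connectivity_noncyclic p G : prime p -> p.-group G ->
  abelian G -> ~~ cyclic G -> vertex_connectivity G (@power_adj gT) = 1%N.
Proof.
move=> p_pr pG abG ncG; apply/eqP; rewrite eqn_leq; apply/andP; split.
  (* Upper bound: the set to remove is the identity alone. *)
  rewrite -(cards1 (1 : gT)).
  apply: (bigminn_le _ _ _ (fun X : {set gT} => #|X|)).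
  rewrite sub1G /=; apply/orP; left; apply/negP=> /forall_inP conn.
  have [x [y [Gx Gy /eqP[]]]] := exists_Ohm1_cycle_neq p G p_pr pG abG ncG.
  have /forall_inP/(_ y Gy)/connectP[s] := conn x Gx.
  (* Induction along the path carries ['Ohm_1] from one end to the other. *)
  move: Gx; elim: s x => [|z s IHs] x Gx /=; first by move=> _ ->.
  case/andP=> /and3P[_ Gz xz] path_s last_s.
  by rewrite (Ohm1_cycle_adj p G x z) // (IHs z).
(* Lower bound: removing nothing does not suffice, since [G] has several vertices, all joined
   through the identity. *)
apply: leq_bigminn => [|X /andP[_]]; first exact: cardG_gt0.
rewrite lt0n cards_eq0; apply: contraL => /eqP->; rewrite setD0 negb_or negbK.
apply/andP; split; last first.
  rewrite /trivial_graph -trivg_card1.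
  by apply: contra ncG => /eqP->; apply: cyclic1.
apply/forall_inP=> x Gx; apply/forall_inP=> y Gy; set e := (X in connect X).
have to1 z : z \in G -> connect e z 1 * connect e 1 z.
  move=> Gz; have [-> | nt_z] := eqVneq z 1; first by rewrite connect0.
  have z1: power_adj z 1 by rewrite power_adj1.
  by split; apply: connect1; apply/and3P; split=> //; rewrite power_adj_sym.
by rewrite (connect_trans (y := 1)) ?to1.
Qed.

Lemma degree_gt0 G x : G :!=: 1 -> x \in G -> 0 < degree G (@power_adj gT) x.
Proof.
move=> ntG Gx; apply/card_gt0P; have [-> | nt_x] := eqVneq x 1.
  have [y Gy nt_y] := trivgPn _ ntG.
  by exists y; rewrite inE Gy power_adj_sym power_adj1.
by exists 1; rewrite inE group1 power_adj1.
Qed.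

(** The identity is always a neighbour of [x]. A second one is [x^-1] if [x] is not an involution,
    or a square root of [x] if there is one. Conversely, any other neighbour of a nonsquare
    involution would have to lie in [<[x]>]. *)
Lemma degree1P p G x : p.-group G -> x \in G^# ->
  degree G (@power_adj gT) x = 1%N <->
  #[x] = 2 /\ {in G, forall y, x != y ^+ 2}.
Proof.
move=> pG; rewrite !inE => /andP[nt_x Gx]; split=> [deg1 | [ox nsq]].
  have nbr y : y \in G -> power_adj x y -> y = 1.
    move/eqP/cards1P: deg1 => [z defN] Gy xy.
    have: y \in [set z] by rewrite -defN inE Gy.
    have: 1 \in [set z] by rewrite -defN inE group1 power_adj1.
    by rewrite !inE => /eqP-> /eqP.
  have ox : #[x] = 2.
    have [xV | ne_xV] := eqVneq x x^-1.
      apply: nt_prime_order => //; first by rewrite expgS expg1 {2}xV mulgV.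
    have /nbr : x^-1 \in G by rewrite groupV.
    rewrite power_adjE ne_xV groupV cycle_id => /(_ isT)/eqP.
    by rewrite invg_eq1 (negPf nt_x).
  split=> // y Gy; apply/eqP=> def_x.
  have /nbr : power_adj x y.
    rewrite power_adjE {3}def_x mem_cycle orbT andbT.
    apply: contraNneq nt_x => eq_xy.
    by rewrite def_x -eq_xy -ox expg_order.
  by move=> /(_ Gy) y1; rewrite def_x y1 expg1n eqxx in nt_x.
have sub_x y : y \in <[x]> -> y != x -> y = 1.
  move=> /cycleP[i ->]; rewrite -expg_mod_order ox modn2.
  by case: (odd i); rewrite ?expg1 ?eqxx.
apply/eqP/cards1P; exists 1; apply/setP=> y; rewrite !inE.
apply/andP/eqP=> [[Gy] | ->]; last by rewrite group1 power_adj1.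
rewrite power_adjE eq_sym => /andP[ne_yx /orP[/sub_x-> //|/cycleP[n def_x]]].
(* Here [x = y ^+ n]; an even [n] would make [x] a square. *)
apply: sub_x => //; have [odd_n | even_n] := boolP (odd n); last first.
  have /eqP[] := nsq (y ^+ n./2) (groupX _ Gy).
  by rewrite -expgM muln2 even_halfK.
(* In a [2]-group an odd [n] is coprime to [#[y]], so [x] generates [<[y]>]. *)
have p2 : p = 2.
  have /pgroupP/(_ 2 isT) := mem_p_elt pG Gx.
  by rewrite -[#|_|]/(#[x]) ox => /(_ isT)/eqnP.
have co_yn : coprime #[y] n.
  have [k ->] := p_natP (mem_p_elt pG Gy).
  by rewrite p2 coprimeXl // coprime2n.
by move: co_yn; rewrite -generator_coprime -def_x => /eqP <-; apply: cycle_id.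
Qed.

Lemma min_degree_noncyclic p G : p.-group G -> ~~ cyclic G ->
  min_degree G (@power_adj gT) = 1%N <->
  exists x, [/\ x \in G, #[x] = 2 & {in G, forall y, x != y ^+ 2}].
Proof.
move=> pG ncG.
have ntG : G :!=: 1 by apply: contraNneq ncG => ->; apply: cyclic1.
split=> [delta1 | [x [Gx ox nsq]]]; last first.
  have G'x : x \in G^# by rewrite !inE Gx -order_gt1 ox.
  apply/eqP; rewrite eqn_leq.
  (* The bound [1] is rewritten as the degree of [x] for the upper estimate, then back for the lower
     one. *)
  have [_ <- //] := degree1P p G x pG G'x.
  rewrite (bigminn_le _ _ _ (degree G (@power_adj gT))) //=.
  have [_ -> //] := degree1P p G x pG G'x.
  apply: leq_bigminn => [|y Gy]; [exact: cardG_gt0 | exact: degree_gt0].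
have [|[x Gx]] := bigminn_attained _ #|G| (mem G) (degree G (@power_adj gT));
  rewrite -[LHS]/(min_degree _ _) delta1.
  by move=> oG; rewrite trivg_card1 -oG in ntG.
move=> deg1.
(* The identity is adjacent to everything else, so degree one there would force [G] to have order
   two and be cyclic. *)
have [x1 | nt_x] := eqVneq x 1.
  have: #|G| = 2.
    rewrite (cardsD1 1 G) group1; congr _.+1.
    rewrite [RHS]deg1 x1; apply: eq_card => y.
    by rewrite !inE power_adj_sym power_adj1 andbC.
  by move=> oG; rewrite prime_cyclic ?oG in ncG.
have [|ox nsq] := (degree1P p G x pG _).1 (esym deg1); last by exists x.
by rewrite !inE nt_x.
Qed.

End PowerGraph.

(** * Orders of cyclic factors and square roots of involutions *)

Section CyclicFactors.

Variable gT : finGroupType.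
Implicit Types (p : nat) (G H : {group gT}) (S : {set {group gT}}).

Lemma sigma_rank p G : p.-group G -> abelian G -> sigma G = 'r(G).
Proof.
move=> pG abG; rewrite -size_abelian_type // /sigma cardE.
have := cyclic_factors_abelian_type pG (cyclic_factorsP abG).
by move/perm_size; rewrite size_map.
Qed.

Lemma sigma1_cyclic p G : p.-group G -> abelian G -> G :!=: 1 ->
  sigma G = 1%N <-> cyclic G.
Proof.
move=> pG abG ntG; rewrite (sigma_rank p) // abelian_rank1_cyclic //.
by split=> [-> // | le1]; apply/eqP; rewrite eqn_leq le1 rank_gt0.
Qed.

Lemma cyclic_decomposition_gt1 S G H :
  cyclic_decomposition S G -> H \in S -> 1 < #|H|.
Proof.
move=> /andP[/forall_inP cS _] /cS/andP[_ /prime_powerP[q [k [q_pr k0 ->]]]].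
by rewrite -(exp1n k) ltn_exp2r ?prime_gt1.
Qed.

Lemma tau2P G : abelian G -> ~~ cyclic G ->
  tau G = 2 <-> exists2 H, H \in cyclic_factors G & #|H| = 2.
Proof.
move=> abG ncG; have dG := cyclic_factorsP abG.
(* This excludes the default value [#|G|] of [tau]. *)
have ncG2 : #|G| != 2 by apply: contra ncG => /eqP oG; rewrite prime_cyclic ?oG.
split=> [tau2 | [H SH oH]].
  have [|[H SH]] := bigminn_attained _ #|G| (mem (cyclic_factors G))
    (fun H : {group gT} => #|H|); rewrite -[LHS]/(tau G) tau2.
    by move=> oG; rewrite -oG in ncG2.
  by exists H.
apply/eqP; rewrite eqn_leq; apply/andP; split.
  by rewrite -oH (bigminn_le _ _ _ (fun H : {group gT} => #|H|)).
apply: leq_bigminn => [|K SK]; last exact: cyclic_decomposition_gt1 dG SK.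
by rewrite cardG_gt1; apply: contraNneq ncG => ->; apply: cyclic1.
Qed.

Lemma sqrt_involution_bigdprod (s : seq {group gT}) G :
  \big[dprod/1]_(H <- s) gval H = G ->
  {in s, forall H : {group gT}, {in H, forall x, x ^+ 2 = 1 ->
    exists2 y, y \in H & x = y ^+ 2}} ->
  {in G, forall x, x ^+ 2 = 1 -> exists2 y, y \in G & x = y ^+ 2}.
Proof.
elim: s G => [|H s IHs] G.
  rewrite big_nil => <- _ x /set1P-> _.
  by exists 1; rewrite ?group1 ?expg1n.
rewrite big_cons => defG sqs x Gx x2.
have [[_ K _ defK] defHK cHK tiHK] := dprodP defG.
rewrite defK in defHK cHK tiHK.
move: Gx; rewrite -defHK => /mulsgP[h k Hh Kk def_x].
have com_hk u v : u \in H -> v \in K -> commute u v.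
  by move=> Hu Kv; apply/commute_sym/(centsP cHK).
move: x2; rewrite def_x expgMn; last exact: com_hk.
(* The inverse of [h ^+ 2] equals [k ^+ 2], so both squares lie in the trivial intersection of [H]
   and [K]. *)
move=> /eqP; rewrite -eq_invg_mul => /eqP h2k2.
have h2 : h ^+ 2 = 1.
  apply/set1P; rewrite -[[set 1]]tiHK inE groupX //=.
  by rewrite -groupV h2k2 groupX.
have k2 : k ^+ 2 = 1 by rewrite -h2k2 h2 invg1.
have [|a Ha ->] := sqs H _ h Hh h2; first exact: mem_head.
have [|b Kb ->] := IHs K defK _ k Kk k2.
  by move=> L sL; apply: sqs; rewrite inE sL orbT.
exists (a * b); first exact: mem_mulg.
by rewrite expgMn //; apply: com_hk.
Qed.

Lemma sqrt_involution_cyclic p H : p.-group H -> cyclic H -> #|H| != 2 ->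
  {in H, forall x, x ^+ 2 = 1 -> exists2 y, y \in H & x = y ^+ 2}.
Proof.
move=> pH /cyclicP[a defH] nH2 x Hx x2.
have [p_2 | p_odd] := eqVneq p 2; last first.
  have [-> | nt_x] := eqVneq x 1; first by exists 1; rewrite ?expg1n.
  have ox : #[x] = 2 by apply: nt_prime_order.
  have /pgroupP/(_ 2 isT) := mem_p_elt pH Hx.
  by rewrite -[#|_|]/(#[x]) ox => /(_ isT)/eqnP p_2; rewrite p_2 eqxx in p_odd.
move: Hx; rewrite defH => /cycleP[i def_x].
have [odd_i | even_i] := boolP (odd i); last first.
  exists (a ^+ i./2); first exact: mem_cycle.
  by rewrite -expgM muln2 even_halfK.
(* For odd [i], [#[a]] divides [2 * i] and hence [2]; order two is excluded, so [H] is trivial. *)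
have [k oa] : {k | #[a] = p ^ k}%N by apply: p_natP; rewrite orderE -defH.
have: #[a] %| i * 2 by rewrite order_dvdn expgM -def_x x2.
rewrite oa p_2 Gauss_dvdr; last by rewrite coprimeXl // coprime2n.
rewrite -{2}(expn1 2) dvdn_Pexp2l //; case: k oa => [|[|//]] oa.
  move=> _; exists 1; rewrite ?group1 // expg1n def_x.
  by rewrite (eqP (_ : a == 1)) ?expg1n // -order_eq1 oa.
by rewrite defH -orderE oa p_2 in nH2.
Qed.

(** If no factor has order two, roots are taken factor by factor. If [H] has order two, squaring
    kills its component, so all squares lie in the complementary factor, which misses the generator
    of [H]. *)
Lemma nonsquare_involutionP p G S : p.-group G -> abelian G ->
  cyclic_decomposition S G ->
  (exists x, [/\ x \in G, #[x] = 2 & {in G, forall y, x != y ^+ 2}]) <->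
  exists2 H, H \in S & #|gval H| = 2.
Proof.
move=> pG abG /andP[/forall_inP cS /eqP defG].
have sHG H : H \in S -> H \subset G.
  by move=> SH; rewrite -(bigdprodWY defG) sub_gen // (bigcup_max H).
split=> [[x [Gx ox nsq]] | [H SH oH]].
  have [/exists_inP[H SH /eqP oH] | /exists_inPn nS2] :=
    boolP [exists H in S, #|gval H| == 2]; first by exists H.
  have [|||y Gy def_x] := sqrt_involution_bigdprod (enum S) G _ _ x Gx.
  - by rewrite big_enum.
  - move=> H; rewrite mem_enum => SH.
    apply: (sqrt_involution_cyclic p) (nS2 H SH).
      exact: pgroupS (sHG H SH) pG.
    by case/andP: (cS H SH).
  - by rewrite -ox expg_order.
  by case/eqP: (nsq y Gy).
have /andP[/cyclicP[x defH] _] := cS H SH.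
have Hx : x \in H by rewrite defH cycle_id.
have ox : #[x] = 2 by rewrite orderE -defH.
exists x; split=> // [|y Gy]; first exact: (subsetP (sHG H SH)).
have defHK : H \x \big[dprod/1]_(K in S | K != H) K = G 
  by rewrite -defG [RHS](bigD1 H).
have [[_ K _ ->] defHK' cHK tiHK] := dprodP defHK.
move: Gy; rewrite -defHK' => /mulsgP[h k Hh Kk ->].
rewrite expgMn; last by apply/commute_sym/(centsP cHK).
have -> : h ^+ 2 = 1 by rewrite -oH expg_cardG.
rewrite mul1g; apply/eqP=> def_x; have: x \in H :&: K.
  by rewrite inE Hx def_x groupX.
by rewrite tiHK => /set1P x1; rewrite x1 order1 in ox.
Qed.

End CyclicFactors.

(* Comparison of the two invariants *)
Local Close Scope group_scope.

Theorem theorem6p8 (gT : finGroupType) (G : {group gT}) (p : nat)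
    (p_prime : prime p) (G_pgroup : (p.-group G)%g)
    (G_abelian : abelian G) (G_nontrivial : (G :!=: 1)%g) :
  vertex_connectivity G (@power_adj gT) = min_degree G (@power_adj gT)
  <-> sigma G = 1 \/ tau G = 2.
Proof.
have [cG | ncG] := boolP (cyclic G).
  have V0 : (G : {set gT}) != set0 by apply/set0Pn; exists 1%g; apply: group1.
  have irr : irreflexive (@power_adj gT) by move=> x; rewrite /power_adj /= eqxx.
  have compl := power_adj_cyclic gT p G G_pgroup cG.
  rewrite vertex_connectivity_complete // min_degree_complete //.
  by split=> // _; left; apply/(sigma1_cyclic gT p).
rewrite (vertex_connectivity_noncyclic gT p) //.
have deltaP := min_degree_noncyclic gT p G G_pgroup ncG.
have facP := nonsquare_involutionP gT p G _ G_pgroup G_abelian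
  (cyclic_factorsP G_abelian).
have tauP := tau2P gT G G_abelian ncG.
split=> [/esym/deltaP/facP/tauP-> | [s1 | /tauP/facP/deltaP-> //]]; first by right.
by case/negP: ncG; apply/(sigma1_cyclic gT p).
Qed.
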